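(* Let $G$ be a Roelcke-precompact Polish group and let $\varphi\colon G \to B$ be its Bohr compactification. Then $\varphi$ is surjective.
   Context: A topological group $G$ is Roelcke-precompact if for every open neighbourhood $U$ of the identity there is a finite set $F \subseteq G$ with $UFU = G$. The Bohr compactification of a topological group $G$ is a continuous homomorphism $\varphi\colon G \to B$ into a compact (Hausdorff) group $B$ which is universal: every continuous homomorphism from $G$ into a compact group factors uniquely through $\varphi$. *)

(* Defs.v *)
From Stdlib Require Import Reals List.
Open Scope R_scope.

Definition is_topology (T : Type) (opn : (T -> Prop) -> Prop) : Prop :=
  opn (fun _ => True) /\
  (forall U V, opn U -> opn V -> opn (fun x => U x /\ V x)) /\
  (forall F : (T -> Prop) -> Prop, (forall U, F U -> opn U) ->
     opn (fun x => exists U, F U /\ U x)).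

Record TopGrp := {
  tg_car :> Type;
  tg_mul : tg_car -> tg_car -> tg_car;
  tg_inv : tg_car -> tg_car;
  tg_one : tg_car;
  tg_open : (tg_car -> Prop) -> Prop;
  tg_mulA : forall x y z, tg_mul x (tg_mul y z) = tg_mul (tg_mul x y) z;
  tg_mul1l : forall x, tg_mul tg_one x = x;
  tg_mul1r : forall x, tg_mul x tg_one = x;
  tg_mulVl : forall x, tg_mul (tg_inv x) x = tg_one;
  tg_mulVr : forall x, tg_mul x (tg_inv x) = tg_one;
  tg_topology : is_topology tg_car tg_open;
  tg_mul_cont : forall (W : tg_car -> Prop) x y, tg_open W -> W (tg_mul x y) ->
      exists U V, tg_open U /\ tg_open V /\ U x /\ V y /\
        forall a b, U a -> V b -> W (tg_mul a b);
  tg_inv_cont : forall W, tg_open W -> tg_open (fun x => W (tg_inv x))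
}.

Arguments tg_mul {t}.
Arguments tg_inv {t}.
Arguments tg_one {t}.
Arguments tg_open {t}.

Definition continuous {G H : TopGrp} (f : G -> H) : Prop :=
  forall W, tg_open W -> tg_open (fun x => W (f x)).

Definition is_hom {G H : TopGrp} (f : G -> H) : Prop :=
  forall x y, f (tg_mul x y) = tg_mul (f x) (f y).

Definition cont_hom {G H : TopGrp} (f : G -> H) : Prop :=
  continuous f /\ is_hom f.

Definition hausdorff (G : TopGrp) : Prop :=
  forall x y : G, x <> y -> exists U V, tg_open U /\ tg_open V /\ U x /\ V y /\
    forall z, ~ (U z /\ V z).

Definition compact (G : TopGrp) : Prop :=
  forall F : (G -> Prop) -> Prop, (forall U, F U -> tg_open U) ->
    (forall x, exists U, F U /\ U x) ->
    exists l : list (G -> Prop), (forall U, In U l -> F U) /\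
      (forall x, exists U, In U l /\ U x).

Definition is_metric {T : Type} (d : T -> T -> R) : Prop :=
  (forall x y, 0 <= d x y) /\ (forall x y, d x y = 0 <-> x = y) /\
  (forall x y, d x y = d y x) /\ (forall x y z, d x z <= d x y + d y z).

Definition metric_complete {T : Type} (d : T -> T -> R) : Prop :=
  forall u : nat -> T,
    (forall eps, eps > 0 -> exists N, forall m n, (m >= N)%nat -> (n >= N)%nat ->
        d (u m) (u n) < eps) ->
    exists l, forall eps, eps > 0 -> exists N, forall n, (n >= N)%nat -> d (u n) l < eps.

Definition metric_induces {G : TopGrp} (d : G -> G -> R) : Prop :=
  forall U : G -> Prop, tg_open U <->
    (forall x, U x -> exists eps, eps > 0 /\ forall y, d x y < eps -> U y).

Definition separable (G : TopGrp) : Prop :=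
  exists s : nat -> G, forall U, tg_open U -> (exists x, U x) -> exists n, U (s n).

Definition polish (G : TopGrp) : Prop :=
  separable G /\
  exists d : G -> G -> R, is_metric d /\ metric_complete d /\ metric_induces d.

Definition roelcke_precompact (G : TopGrp) : Prop :=
  forall U : G -> Prop, tg_open U -> U tg_one ->
    exists F : list G, forall g : G, exists u1 f u2,
      U u1 /\ In f F /\ U u2 /\ g = tg_mul (tg_mul u1 f) u2.

Definition bohr_compactification (G B : TopGrp) (phi : G -> B) : Prop :=
  compact B /\ hausdorff B /\ cont_hom phi /\
  forall (K : TopGrp) (psi : G -> K), compact K -> hausdorff K -> cont_hom psi ->
    exists chi : B -> K, (cont_hom chi /\ forall g, chi (phi g) = psi g) /\
      forall chi' : B -> K, cont_hom chi' -> (forall g, chi' (phi g) = psi g) ->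
        forall b, chi' b = chi b.

(* Main.v *)
(** The image of [phi] is dense: [phi] factors through the closure of its image,
    and uniqueness in the universal property forces that closure to be all of [B].

    Let [U] be a symmetric neighbourhood of 1 in [G], with [G = U F U] and [F]
    finite. Then [B] is the union of the closures of [phi(U f U)], [f] in [F].
    Discarding the closures that miss 1 leaves a neighbourhood of 1; and if 1 is
    adherent to [phi(U f U)], then, as conjugation in the compact group [B] is
    equicontinuous, the closure of [phi(U f U)] lies in the closure of
    [phi(U^4)]. Hence [phi] is nearly open.

    Finally, given [b], the nearly open continuous maps [phi] and
    [b * phi] on the completely metrizable space [G] have a common value, by
    shrinking two sequences of open sets whose images remain dense in a common
    nonempty open subset of [B]. So [b = phi g * (phi h)^-1]. *)
From Stdlib Require Import Reals List Lra Lia.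
From Stdlib Require Import Classical ClassicalEpsilon.
From Stdlib Require Import FunctionalExtensionality PropExtensionality.
Require Import Defs.

Declare Scope tg_scope.
Local Infix "*" := tg_mul : tg_scope.
Local Notation "x ^-1" := (tg_inv x) (at level 3, format "x ^-1") : tg_scope.
Local Notation "1" := tg_one : tg_scope.
Local Open Scope tg_scope.

(** * Group identities *)

Section Group_identities.
Variable G : TopGrp.
Implicit Types x y z : G.

Lemma tg_mulAr x y z : (x * y) * z = x * (y * z).
Proof. symmetry; apply tg_mulA. Qed.

Lemma tg_mulKl x y : x^-1 * (x * y) = y.
Proof. now rewrite tg_mulA, tg_mulVl, tg_mul1l. Qed.

Lemma tg_mulVKl x y : x * (x^-1 * y) = y.
Proof. now rewrite tg_mulA, tg_mulVr, tg_mul1l. Qed.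

Lemma tg_inv_unique x y : x * y = 1 -> x^-1 = y.
Proof. intros H; now rewrite <- (tg_mulKl x y), H, tg_mul1r. Qed.

Lemma tg_invK x : x^-1^-1 = x.
Proof. apply tg_inv_unique, tg_mulVl. Qed.

Lemma tg_invM x y : (x * y)^-1 = y^-1 * x^-1.
Proof. apply tg_inv_unique; now rewrite tg_mulAr, tg_mulVKl, tg_mulVr. Qed.

Lemma tg_inv1 : 1^-1 = 1 :> G.
Proof. apply tg_inv_unique, tg_mul1l. Qed.

End Group_identities.

Hint Rewrite tg_mulAr tg_mulKl tg_mulVKl tg_invK tg_invM tg_inv1
  tg_mul1l tg_mul1r tg_mulVl tg_mulVr : tg_group.

Ltac group := autorewrite with tg_group; auto.

Section Homomorphisms.
Variables (G H : TopGrp) (f : G -> H).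
Hypothesis fM : is_hom f.

Lemma hom_one : f 1 = 1.
Proof.
  rewrite <- (tg_mulKl _ (f 1) (f 1)), <- fM, tg_mul1l; apply tg_mulVl.
Qed.

Lemma hom_inv x : f x^-1 = (f x)^-1.
Proof.
  symmetry; apply tg_inv_unique; rewrite <- fM, tg_mulVr; apply hom_one.
Qed.

End Homomorphisms.

(** * Neighbourhoods *)

Lemma open_True (G : TopGrp) : tg_open (fun _ : G => True).
Proof. exact (proj1 (tg_topology G)). Qed.

Lemma open_and (G : TopGrp) (U V : G -> Prop) :
  tg_open U -> tg_open V -> tg_open (fun x => U x /\ V x).
Proof. apply (proj1 (proj2 (tg_topology G))). Qed.

Lemma open_ext (G : TopGrp) (U V : G -> Prop) :
  (forall x, U x <-> V x) -> tg_open U -> tg_open V.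
Proof.
  intros UV oU; replace V with U; auto.
  extensionality x; now apply propositional_extensionality.
Qed.

(** Intersect the finitely many neighbourhoods; since [P t] passes to smaller sets, each property
    survives the intersection. *)
Lemma finite_common_nbhd (T : Type) (B : TopGrp) (x : B)
    (P : T -> (B -> Prop) -> Prop) (l : list T) :
  (forall t (U V : B -> Prop), (forall y, V y -> U y) -> P t U -> P t V) ->
  (forall t, In t l -> exists U, tg_open U /\ U x /\ P t U) ->
  exists U, tg_open U /\ U x /\ forall t, In t l -> P t U.
Proof.
  intros mono; induction l as [|t l IH]; intros H.
  - exists (fun _ => True); repeat split; [apply open_True | intros t []].
  - destruct IH as (U & oU & Ux & HU); [intros; apply H; now right |].
    destruct (H t) as (V & oV & Vx & HV); [now left |].
    exists (fun y => U y /\ V y); repeat split; auto using open_and.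
    intros s [<- | Hs]; [apply (mono t V) | apply (mono s U)]; intuition.
Qed.

Lemma small_nbhd_pow4 (G : TopGrp) (A : G -> Prop) : tg_open A -> A 1 ->
  exists U : G -> Prop, tg_open U /\ U 1 /\ (forall x, U x -> U x^-1) /\
    forall a b c d, U a -> U b -> U c -> U d -> A ((a * b) * (c * d)).
Proof.
  intros oA A1.
  assert (half : forall W : G -> Prop, tg_open W -> W 1 ->
    exists V : G -> Prop, tg_open V /\ V 1 /\
      forall a b, V a -> V b -> W (a * b)).
  { intros W oW W1; rewrite <- (tg_mul1l G 1) in W1.
    destruct (tg_mul_cont G W 1 1 oW W1) as (V1 & V2 & o1 & o2 & H1 & H2 & HV).
    exists (fun x => V1 x /\ V2 x); repeat split; auto using open_and.
    intros a b [] []; auto. }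
  destruct (half A oA A1) as (V & oV & V1 & HV).
  destruct (half V oV V1) as (U & oU & U1 & HU).
  exists (fun x => U x /\ U x^-1); repeat split; auto using open_and, tg_inv_cont.
  - now rewrite tg_inv1.
  - tauto.
  - now rewrite tg_invK.
  - intros a b c d [] [] [] []; auto.
Qed.

(** Tube-lemma argument: joint continuity of [a^-1 * (w * a)] at [(a, 1)] gives a neighbourhood of
    [a] and a neighbourhood of 1. Finitely many of the former cover [B], and the matching ones of
    the latter are intersected. *)
Lemma compact_conj_equicontinuous (B : TopGrp) (W : B -> Prop) :
  compact B -> tg_open W -> W 1 ->
  exists V : B -> Prop, tg_open V /\ V 1 /\
    forall a w, V w -> W (a^-1 * (w * a)).
Proof.
  intros cB oW W1.
  pose (P (A V : B -> Prop) := forall a w, A a -> V w -> W (a^-1 * (w * a))).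
  destruct (cB (fun A => tg_open A /\ exists V, tg_open V /\ V 1 /\ P A V))
    as (l & Hl & cov).
  - now intros U [].
  - intros a.
    assert (Wa : W (a^-1 * (1 * a))) by group.
    destruct (tg_mul_cont B W _ _ oW Wa) as (X & Y & oX & oY & Xa & Ya & HXY).
    destruct (tg_mul_cont B Y _ _ oY Ya) as (V & Z & oV & oZ & V1 & Za & HVZ).
    exists (fun x => X x^-1 /\ Z x); repeat split; auto.
    + apply open_and; auto; now apply tg_inv_cont.
    + exists V; repeat split; auto; intros c w [] ?; auto.
  - destruct (finite_common_nbhd _ B 1 P l) as (V & oV & V1 & HV).
    + intros A U V HVU H a w Aa Vw; auto.
    + intros A HA; apply Hl in HA; tauto.
    + exists V; repeat split; auto; intros a w Vw.
      destruct (cov a) as (A & HA & Aa); now apply (HV A HA).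
Qed.

(** * Closures of images *)

Definition closure_image {T : Type} {B : TopGrp} (f : T -> B) (A : T -> Prop)
    (b : B) : Prop :=
  forall W, tg_open W -> W b -> exists x, A x /\ W (f x).

(** * Closed subgroups of compact groups *)

Section Subgroup.
Variables (B : TopGrp) (H : B -> Prop).
Hypotheses (H1 : H 1) (HM : forall x y, H x -> H y -> H (x * y))
  (HV : forall x, H x -> H x^-1).

Definition subgroup_open (V : {b | H b} -> Prop) : Prop :=
  exists U, tg_open U /\ forall z, V z <-> U (proj1_sig z).

Lemma subgroup_topology : is_topology {b | H b} subgroup_open.
Proof.
  split; [| split].
  - exists (fun _ => True); split; [apply open_True | tauto].
  - intros U V (U' & oU & HU) (V' & oV & HV').
    exists (fun x => U' x /\ V' x); split; [auto using open_and |].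
    intros z; now rewrite HU, HV'.
  - intros F HF.
    (* The union of all ambient open sets whose trace lies in [F]; this avoids choosing one
       extension per member. *)
    exists (fun x => exists U,
      (tg_open U /\ exists V, F V /\ forall z, V z <-> U (proj1_sig z)) /\ U x).
    split.
    + apply (proj2 (proj2 (tg_topology B))); now intros U [].
    + intros z; split.
      * intros (V & FV & Vz); destruct (HF V FV) as (U & oU & HU).
        exists U; split; [eauto | now apply HU].
      * intros (U & (oU & V & FV & HV') & Uz); exists V; split; auto.
        now apply HV'.
Qed.

Lemma subgroup_eq (x y : {b | H b}) : proj1_sig x = proj1_sig y -> x = y.
Proof. apply eq_sig_hprop; intros; apply proof_irrelevance. Qed.

Definition subgroup : TopGrp.
Proof.
  refine {|
    tg_car := {b | H b};
    tg_mul x y := exist _ (proj1_sig x * proj1_sig y)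
      (HM _ _ (proj2_sig x) (proj2_sig y));
    tg_inv x := exist _ (proj1_sig x)^-1 (HV _ (proj2_sig x));
    tg_one := exist _ 1 H1;
    tg_open := subgroup_open;
    tg_topology := subgroup_topology |};
    try (intros; apply subgroup_eq; cbn; group; fail).
  - intros W x y (U & oU & HU) Wxy; apply HU in Wxy.
    destruct (tg_mul_cont B U _ _ oU Wxy) as (X & Y & oX & oY & Xx & Yy & HXY).
    exists (fun z => X (proj1_sig z)), (fun z => Y (proj1_sig z)).
    split; [exists X; intuition |]; split; [exists Y; intuition |].
    repeat split; auto; intros a b Xa Yb; apply HU; cbn; auto.
  - intros W (U & oU & HU).
    exists (fun x => U x^-1); split; [now apply tg_inv_cont |].
    intros z; apply HU.
Defined.

Lemma subgroup_hausdorff : hausdorff B -> hausdorff subgroup.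
Proof.
  intros hB x y xy.
  destruct (hB (proj1_sig x) (proj1_sig y)) as (U & V & oU & oV & Ux & Vy & UV).
  { intros E; now apply xy, subgroup_eq. }
  exists (fun z : subgroup => U (proj1_sig z)),
    (fun z : subgroup => V (proj1_sig z)).
  split; [exists U; intuition |]; split; [exists V; intuition |].
  repeat split; auto; intros z; apply UV.
Qed.

Lemma closed_subgroup_compact : compact B ->
  (forall b, ~ H b -> exists U, tg_open U /\ U b /\ forall x, H x -> ~ U x) ->
  compact subgroup.
Proof.
  intros cB clH F HF cov.
  (* A cover of all of [B]: open sets whose trace on [H] fits into a member of [F], together with
     the open sets that miss [H]. *)
  pose (F' (U : B -> Prop) := tg_open U /\
    ((exists V, F V /\ forall z : subgroup, U (proj1_sig z) -> V z) \/
     forall x, H x -> ~ U x)).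
  destruct (cB F') as (l & Hl & covl).
  - now intros U [].
  - intros b; destruct (classic (H b)) as [Hb | nHb].
    + destruct (cov (exist _ b Hb)) as (V & FV & Vb).
      destruct (HF V FV) as (U & oU & HU).
      exists U; split; [split; auto; left; exists V; split; auto |].
      * intros z; apply HU.
      * now apply HU in Vb.
    + destruct (clH b nHb) as (U & oU & Ub & HU); exists U; split; auto.
      split; auto.
  (* Drop the sets that miss [H] and replace each other one by a member of [F] containing its
     trace. *)
  - assert (sub : exists l' : list (subgroup -> Prop),
      (forall V, In V l' -> F V) /\ forall U, In U l ->
        forall z : subgroup, U (proj1_sig z) -> exists V, In V l' /\ V z).
    { clear covl; induction l as [|U l IH].
      - exists nil; split; [intros V [] | intros U []].
      - destruct IH as (l' & Hl' & IH); [intros; apply Hl; now right |].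
        destruct (Hl U) as (_ & [(V & FV & HV') | HU]); [now left | |].
        + exists (V :: l'); split; [intros X [<- | HX]; auto |].
          intros X [<- | HX] z Xz; [exists V; split; [now left | auto] |].
          destruct (IH X HX z Xz) as (Y & HY & Yz); exists Y; split; auto.
          now right.
        + exists l'; split; auto.
          intros X [<- | HX] z Xz; [| now apply (IH X)].
          destruct (HU _ (proj2_sig z) Xz). }
    destruct sub as (l' & Hl' & HV'); exists l'; split; auto.
    intros z; destruct (covl (proj1_sig z)) as (U & HU & Uz); eauto.
Qed.

End Subgroup.

(** * Density of the image in the Bohr compactification *)

Section Dense_image.
Variables (G B : TopGrp) (phi : G -> B).
Hypothesis phiM : is_hom phi.

Local Notation cl := (closure_image phi (fun _ => True)).

Lemma closure_image_one : cl 1.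
Proof. intros W _ W1; exists 1; now rewrite hom_one. Qed.

Lemma closure_image_mul x y : cl x -> cl y -> cl (x * y).
Proof.
  intros cx cy W oW Wxy.
  destruct (tg_mul_cont B W x y oW Wxy) as (U & V & oU & oV & Ux & Vy & HUV).
  destruct (cx U oU Ux) as (g & _ & Ug), (cy V oV Vy) as (h & _ & Vh).
  exists (g * h); rewrite phiM; auto.
Qed.

Lemma closure_image_inv x : cl x -> cl x^-1.
Proof.
  intros cx W oW Wx.
  destruct (cx _ (tg_inv_cont B W oW) Wx) as (g & _ & Wg).
  exists g^-1; now rewrite hom_inv.
Qed.

Lemma bohr_dense : bohr_compactification G B phi -> forall b, cl b.
Proof.
  intros (cB & hB & [phiC _] & univ).
  pose (K := subgroup B cl closure_image_one closure_image_mul closure_image_inv).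
  assert (im : forall g, cl (phi g)) by (intros g W _ Wg; now exists g).
  pose (psi (g : G) := exist cl (phi g) (im g) : K).
  destruct (univ K psi) as (chi & [[chiC chiM] Hchi] & _).
  - apply closed_subgroup_compact; auto.
    intros b nb; apply not_all_ex_not in nb as [U nb].
    apply imply_to_and in nb as [oU nb]; apply imply_to_and in nb as [Ub nb].
    exists U; repeat split; auto.
  - now apply subgroup_hausdorff.
  - split.
    + intros W (U & oU & HU).
      apply (open_ext G (fun x => U (phi x))); [| now apply phiC].
      intros x; symmetry; apply (HU (psi x)).
    + intros x y; apply subgroup_eq, phiM.
  (* With [phi] itself as target map, both the identity of [B] and [chi] followed by the inclusion
     of [K] are factorizations. Hence they agree, and every [b] is the value of a point of [K]. *)
  - destruct (univ B phi) as (eta & _ & uniq); auto; [now split |].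
    intros b; replace b with (proj1_sig (chi b)); [apply (proj2_sig (chi b)) |].
    rewrite (uniq (fun b => proj1_sig (chi b))), <- (uniq (fun b => b)); auto.
    + split; [intros W oW; exact oW | intros x y; reflexivity].
    + split; [| intros x y; now rewrite chiM].
      intros W oW; apply (chiC (fun z => W (proj1_sig z))); now exists W.
    + intros g; now rewrite Hchi.
Qed.

End Dense_image.

(** * Nearly open maps *)

Definition nearly_open {G B : TopGrp} (f : G -> B) : Prop :=
  forall (A : G -> Prop) g, tg_open A -> A g ->
    exists P, tg_open P /\ P (f g) /\ forall b, P b -> closure_image f A b.

Lemma roelcke_nearly_open_one (G B : TopGrp) (phi : G -> B) (A : G -> Prop) :
  roelcke_precompact G -> compact B -> is_hom phi ->
  (forall b, closure_image phi (fun _ => True) b) -> tg_open A -> A 1 ->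
  exists P, tg_open P /\ P 1 /\ forall b, P b -> closure_image phi A b.
Proof.
  intros rG cB phiM dense oA A1.
  destruct (small_nbhd_pow4 G A oA A1) as (U & oU & U1 & UV & U4).
  destruct (rG U oU U1) as (F & HF).
  pose (S f x := exists u1 u2, U u1 /\ U u2 /\ x = (u1 * f) * u2).
  (* If 1 is not adherent to [phi(S f)], a neighbourhood of 1 missing [phi(S f)] contains no
     adherent point of it; otherwise any neighbourhood will do. *)
  destruct (finite_common_nbhd _ B 1 (fun f O =>
      forall b, O b -> closure_image phi (S f) b -> closure_image phi (S f) 1) F)
    as (O & oO & O1 & HO).
  { intros f V W WV H b Wb; apply H; auto. }
  { intros f _; destruct (classic (closure_image phi (S f) 1)) as [c | nc].
    - exists (fun _ => True); split; auto using open_True.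
    - apply not_all_ex_not in nc as [W nc].
      apply imply_to_and in nc as [oW nc]; apply imply_to_and in nc as [W1 nc].
      exists W; repeat split; auto; intros b Wb cb; destruct nc; now apply cb. }
  exists O; repeat split; auto; intros b Ob.
  (* Otherwise some neighbourhood of [b] misses [phi(S f)] for every [f] in [F]. These sets exhaust
     the image of [phi], contradicting density. *)
  assert (cov : exists f, In f F /\ closure_image phi (S f) b).
  { apply NNPP; intros no.
    destruct (finite_common_nbhd _ B b
      (fun f V => forall x, S f x -> ~ V (phi x)) F) as (V & oV & Vb & HV).
    - intros f V W WV H x Sx Wx; now apply (H x Sx), WV.
    - intros f Ff; apply NNPP; intros no'; apply no; exists f; split; auto.
      intros W oW Wb; apply NNPP; intros no''; apply no'; exists W.
      repeat split; auto; intros x Sx Wx; apply no''; eauto.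
    - destruct (dense b V oV Vb) as (g & _ & Vg).
      destruct (HF g) as (u1 & f & u2 & Uu1 & Ff & Uu2 & E).
      apply (HV f Ff g); auto; exists u1, u2; auto. }
  destruct cov as (f & Ff & cb); assert (c1 := HO f Ff b Ob cb).
  intros W oW Wb; rewrite <- (tg_mul1r B b) in Wb.
  destruct (tg_mul_cont B W b 1 oW Wb) as (W1 & W2 & o1 & o2 & H1 & H2 & HW).
  (* [h] will be chosen with [phi h^-1] in [W3]. All conjugates of that element then lie in [W2],
     whatever the conjugating element, which depends on the later choice of [k]. *)
  destruct (compact_conj_equicontinuous B W2 cB o2 H2) as (W3 & o3 & H3 & conj).
  destruct (c1 _ (tg_inv_cont B W3 o3)) as (h & (u1 & u2 & Uu1 & Uu2 & Eh) & Wh).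
  { now rewrite tg_inv1. }
  destruct (cb W1 o1 H1) as (k & (v1 & v2 & Uv1 & Uv2 & Ek) & Wk).
  exists ((v1 * u1^-1) * (u2^-1 * v2)); split; [auto |].
  (* With [y = u2^-1 v2], this element is [k] times the conjugate of [h^-1] by [y]. *)
  set (y := u2^-1 * v2).
  replace ((v1 * u1^-1) * y) with (k * (y^-1 * (h^-1 * y))).
  - rewrite !phiM, !hom_inv; auto.
  - subst h k y; group.
Qed.

(** Transport from 1 by translation: [A] contains some [g * V], whose image is [c * phi g] times
    [phi(V)]. The factor [c] allows comparing [phi] with its translates. *)
Lemma hom_nearly_open (G B : TopGrp) (phi : G -> B) : is_hom phi ->
  (forall A : G -> Prop, tg_open A -> A 1 ->
    exists P, tg_open P /\ P 1 /\ forall b, P b -> closure_image phi A b) ->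
  forall c : B, nearly_open (fun g => c * phi g).
Proof.
  intros phiM near c A g oA Ag; rewrite <- (tg_mul1r G g) in Ag.
  destruct (tg_mul_cont G A g 1 oA Ag) as (X & V & oX & oV & Xg & V1 & HV).
  destruct (near V oV V1) as (P & oP & P1 & HP).
  assert (Pg : P ((c * phi g)^-1 * (c * phi g))) by group.
  destruct (tg_mul_cont B P _ _ oP Pg) as (Y & Q & oY & oQ & Yg & Qg & HQ).
  exists Q; repeat split; auto; intros b Qb W oW Wb.
  assert (Wb' : W ((c * phi g) * ((c * phi g)^-1 * b))) by now rewrite tg_mulVKl.
  destruct (tg_mul_cont B W _ _ oW Wb') as (Z & T & oZ & oT & Zg & Tb & HT).
  destruct (HP _ (HQ _ _ Yg Qb) T oT Tb) as (v & Vv & Tv).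
  exists (g * v); split; auto; rewrite phiM, tg_mulA; auto.
Qed.

(** A variant of Cantor's intersection theorem without closedness: points chosen in the sets form a
    Cauchy sequence, and the sets shrink to its limit, which need not belong to them. [A 0] carries
    no diameter bound, hence the index shift. *)
Lemma nested_small_sets_converge (T : Type) (d : T -> T -> R)
    (A : nat -> T -> Prop) :
  is_metric d -> metric_complete d -> (forall n, exists x, A n x) ->
  (forall n x, A (S n) x -> A n x) ->
  (forall n x y, A (S n) x -> A (S n) y -> (d x y < / INR (S n))%R) ->
  exists l, forall r, (r > 0)%R -> exists n, forall x, A n x -> (d l x < r)%R.
Proof.
  intros (_ & _ & dsym & dtri) dc ne nest small.
  assert (mono : forall n m, (n <= m)%nat -> forall x, A m x -> A n x)
    by (induction 1; auto).
  pose (u n := proj1_sig (constructive_indefinite_description _ (ne n))).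
  assert (Au : forall n, A n (u n)) by (intros n; apply proj2_sig).
  assert (arch : forall e, (e > 0)%R -> exists n, (/ INR (S n) < e)%R).
  { intros e He; destruct (archimed_cor1 e He) as ([|n] & Hn & Hp); [lia |].
    now exists n. }
  destruct (dc u) as (l & Hl).
  - intros e He; destruct (arch e He) as (n & Hn); exists (S n); intros p q Hp Hq.
    apply Rlt_trans with (2 := Hn), small;
      [apply (mono _ p) | apply (mono _ q)]; auto.
  - exists l; intros r Hr; destruct (arch (r / 2)%R) as (n & Hn); [lra |].
    exists (S n); intros x Ax; destruct (Hl (r / 2)%R) as (N & HN); [lra |].
    specialize (HN (max N (S n)) ltac:(lia)).
    assert (Hm := small n _ x (mono (S n) (max N (S n)) ltac:(lia) _ (Au _)) Ax).
    specialize (dtri l (u (max N (S n))) x); rewrite (dsym l (u _)) in dtri; lra.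
Qed.

(** * Common values of nearly open maps on a complete metric space *)

Section Common_value.
Variables (G B : TopGrp) (d : G -> G -> R).
Hypotheses (dm : is_metric d) (dc : metric_complete d) (di : @metric_induces G d).

Lemma ball_open g e : tg_open (fun x : G => (d g x < e)%R).
Proof.
  apply di; intros x Hx; exists (e - d g x)%R; split; [lra |].
  intros y Hy; destruct dm as (_ & _ & _ & dtri).
  specialize (dtri g x y); lra.
Qed.

(** Cut [A] down to a small ball around a point [g] of [A] with [f g] in [O]. Near openness keeps
    the image dense around [f g], so [O] only has to shrink to a neighbourhood of [f g]. *)
Lemma nearly_open_shrink (f : G -> B) (A : G -> Prop) (O : B -> Prop) e :
  nearly_open f -> (e > 0)%R -> tg_open A -> tg_open O -> (exists b, O b) ->
  (forall b, O b -> closure_image f A b) ->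
  exists (A' : G -> Prop) (O' : B -> Prop),
    tg_open A' /\ tg_open O' /\ (exists b, O' b) /\
    (forall b, O' b -> closure_image f A' b) /\ (forall b, O' b -> O b) /\
    (forall x, A' x -> A x) /\ (forall x y, A' x -> A' y -> (d x y < e)%R).
Proof.
  intros nf He oA oO [b Ob] HO.
  destruct (HO b Ob O oO Ob) as (g & Ag & Og).
  pose (A' x := A x /\ (d g x < e / 2)%R).
  assert (oA' : tg_open A') by (apply open_and; auto using ball_open).
  destruct dm as (_ & d0 & dsym & dtri).
  destruct (nf A' g oA') as (P & oP & Pg & HP).
  { split; auto; rewrite (proj2 (d0 g g) eq_refl); lra. }
  exists A', (fun x => O x /\ P x); repeat split; auto using open_and.
  - now exists (f g).
  - intros c []; auto.
  - tauto.
  - now intros x [].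
  - intros x y [_ Hx] [_ Hy]; specialize (dtri x g y); rewrite (dsym x g) in dtri; lra.
Qed.

Lemma nearly_open_common_value (f1 f2 : G -> B) : hausdorff B ->
  continuous f1 -> continuous f2 -> nearly_open f1 -> nearly_open f2 ->
  (forall b, closure_image f1 (fun _ => True) b) ->
  (forall b, closure_image f2 (fun _ => True) b) ->
  exists g h, f1 g = f2 h.
Proof.
  intros hB c1 c2 n1 n2 dense1 dense2.
  pose (state := ((G -> Prop) * (G -> Prop) * (B -> Prop))%type).
  pose (good (s : state) := let '(A1, A2, P) := s in
    (tg_open A1 /\ tg_open A2 /\ tg_open P /\ exists b, P b) /\
    (forall b, P b -> closure_image f1 A1 b) /\
    forall b, P b -> closure_image f2 A2 b).
  pose (shrinks (A A' : G -> Prop) n := (forall x, A' x -> A x) /\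
    forall x y, A' x -> A' y -> (d x y < / INR (S n))%R).
  assert (step : forall n (s : {s | good s}), exists s' : {s | good s},
    shrinks (fst (fst (proj1_sig s))) (fst (fst (proj1_sig s'))) n /\
    shrinks (snd (fst (proj1_sig s))) (snd (fst (proj1_sig s'))) n).
  { intros n [[[A1 A2] O] ((o1 & o2 & oO & ne) & H1 & H2)]; cbn.
    assert (He : (/ INR (S n) > 0)%R)
      by apply Rinv_0_lt_compat, lt_0_INR, Nat.lt_0_succ.
    destruct (nearly_open_shrink f1 A1 O _ n1 He o1 oO ne H1)
      as (A1' & O' & o1' & oO' & ne' & H1' & O'O & sub1 & small1).
    (* The second shrinking starts from [O']; as [O''] lies inside [O'], the image of [A1'] stays
       dense in it. *)
    destruct (nearly_open_shrink f2 A2 O' _ n2 He o2 oO' ne')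
      as (A2' & O'' & o2' & oO'' & ne'' & H2'' & O''O' & sub2 & small2); auto.
    unshelve eexists (exist _ (A1', A2', O'') _); [| now split].
    repeat split; auto. }
  assert (s0 : {s | good s}).
  { exists (fun _ => True, fun _ => True, fun _ => True).
    split; [| split; auto].
    do 3 (split; [apply open_True |]); now exists 1. }
  pose (next n s := proj1_sig (constructive_indefinite_description _ (step n s))).
  pose (s := nat_rect (fun _ => {s | good s}) s0 next).
  pose (A1 n := fst (fst (proj1_sig (s n)))).
  pose (A2 n := snd (fst (proj1_sig (s n)))).
  pose (O n := snd (proj1_sig (s n))).
  assert (Hs : forall n, shrinks (A1 n) (A1 (S n)) n /\ shrinks (A2 n) (A2 (S n)) n).
  { intros n.
    exact (proj2_sig (constructive_indefinite_description _ (step n (s n)))). }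
  assert (Hg : forall n, good (A1 n, A2 n, O n)).
  { intros n; unfold A1, A2, O; destruct (s n) as [[[X Y] Z] g]; exact g. }
  (* The sets [A n] shrink to a point [g], so by continuity their images eventually enter each
     neighbourhood of [f g]. *)
  assert (lim : forall (f : G -> B) (A : nat -> G -> Prop), continuous f ->
    (forall n b, O n b -> closure_image f (A n) b) ->
    (forall n, shrinks (A n) (A (S n)) n) ->
    exists g, forall W, tg_open W -> W (f g) ->
      exists n, forall m, (n <= m)%nat -> forall x, A m x -> W (f x)).
  { intros f A cf HA sh.
    destruct (nested_small_sets_converge G d A) as (g & Hlim); auto.
    - intros n; destruct (Hg n) as ((_ & _ & oO & b & Ob) & _).
      destruct (HA n b Ob _ (open_True B) I) as (x & Ax & _); eauto.
    - intros n; apply sh.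
    - intros n; apply sh.
    - exists g; intros W oW Wg.
      destruct (proj1 (di _) (cf W oW) g Wg) as (e & He & Hball).
      destruct (Hlim e He) as (n & Hn); exists n; intros m nm x Ax.
      apply Hball, Hn.
      revert x Ax; induction nm; auto; intros x Ax; apply IHnm, sh, Ax. }
  destruct (lim f1 A1 c1) as (g & Hg1); [apply Hg | apply Hs |].
  destruct (lim f2 A2 c2) as (h & Hh2); [apply Hg | apply Hs |].
  exists g, h; apply NNPP; intros neq.
  destruct (hB _ _ neq) as (V & W & oV & oW & Vg & Wh & VW).
  destruct (Hg1 V oV Vg) as (n & Hn), (Hh2 W oW Wh) as (m & Hm).
  (* At this stage [f1] maps [A1] into [V] and [f2] maps [A2] into [W]. A value [f1 x] in [O] has
     [V] as a neighbourhood, and density of the image of [A2] in [O] puts a value of [f2] into [V],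
     though [V] and [W] are disjoint. *)
  destruct (Hg (max n m)) as ((_ & _ & oO & b & Ob) & H1 & H2).
  destruct (H1 b Ob _ oO Ob) as (x & Ax & Ox).
  assert (Vx := Hn (max n m) ltac:(lia) x Ax).
  destruct (H2 _ Ox V oV Vx) as (y & Ay & Vy).
  apply (VW (f2 y)); split; auto; apply (Hm (max n m)); auto; lia.
Qed.

End Common_value.

Theorem theorem5p5 (G B : TopGrp) (phi : G -> B) :
  polish G -> roelcke_precompact G -> bohr_compactification G B phi ->
  forall b : B, exists g : G, phi g = b.
Proof.
  intros (_ & d & dm & dc & di) rG bohr b.
  assert (dense := bohr_dense G B phi (proj2 (proj1 (proj2 (proj2 bohr)))) bohr).
  destruct bohr as (cB & hB & [phiC phiM] & _).
  assert (near : forall c : B, nearly_open (fun g => c * phi g)).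
  { apply hom_nearly_open; auto; intros A oA A1.
    now apply roelcke_nearly_open_one. }
  assert (transC : forall c : B, continuous (fun g => c * phi g)).
  { intros c W oW; apply di; intros x Wx.
    destruct (tg_mul_cont B W _ _ oW Wx) as (U & V & oU & oV & Uc & Vx & HUV).
    destruct (proj1 (di _) (phiC V oV) x Vx) as (e & He & Hball).
    exists e; split; auto; intros y Hy; apply HUV; auto. }
  assert (transD : forall c x : B,
    closure_image (fun g => c * phi g) (fun _ => True) x).
  { intros c x W oW Wx.
    assert (Wx' : W (c * (c^-1 * x))) by now rewrite tg_mulVKl.
    destruct (tg_mul_cont B W _ _ oW Wx') as (U & V & oU & oV & Uc & Vx & HUV).
    destruct (dense _ V oV Vx) as (g & _ & Vg); exists g; auto. }
  (* Writing [phi g] as [1 * phi g] lets the facts about translates, with [c] equal to 1 and to [b],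
     serve both maps. *)
  destruct (nearly_open_common_value G B d dm dc di
    (fun g => 1 * phi g) (fun g => b * phi g)) as (g & h & E); auto.
  exists (g * h^-1); rewrite phiM, hom_inv, <- (tg_mul1l B (phi g)), E; auto.
  group.
Qed.
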